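(* For every sufficiently large integer $n$ the following holds. Suppose that $G$ is a graph with $v(G)=n$, $b$ is a positive integer with $b\leq \frac{\delta(G)}{4\ln n}$, and $c$ is an integer such that $c(2b+1)\leq \frac{\delta(G)}{3}$. Then, in the $(1:b)$ Maker-Breaker game played on $E(G)$, Maker has a strategy to build a graph with minimum degree at least $c$. Moreover, Maker can do so within $cn$ moves and in such a way that throughout the game, for every $v\in V(G)$, as long as $d_M(v)\leq c$, we have $d_B(v)-2b\cdot d_M(v)\leq b(2\ln n+1)$.
   Context: A $(1:b)$ Maker-Breaker game on the edge set $E(G)$ of a graph $G$: two players, Maker and Breaker, alternately claim previously unclaimed edges of $G$, with Breaker going first; in each move Breaker claims $b$ unclaimed edges and Maker claims one unclaimed edge. At any moment, $M$ denotes the graph (on $V(G)$) of edges claimed by Maker and $B$ the graph of edges claimed by Breaker; $d_M(v)$, $d_B(v)$ are the degrees of $v$ in these graphs. $\delta(G)$ is the minimum degree of $G$, $v(G)=|V(G)|$, and $\ln$ is the natural logarithm.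
   Formalization: The danger bound is claimed for v only up to and including the moment d_M(v) first reaches c, not at later moments when d_M(v) still equals c; with those moments included the claim fails (b=c=1, complete bipartite graph with parts ⌈4 ln n⌉ and the rest). *)

(* Defs.v *)
From mathcomp Require Import all_boot all_order all_algebra.

Set Implicit Arguments.
Unset Strict Implicit.
Unset Printing Implicit Defensive.

Record sgraph := SGraph {
  vertex :> finType;
  adj : rel vertex;
  adj_sym : symmetric adj;
  adj_irr : irreflexive adj
}.

Definition edges (G : sgraph) : {set {set G}} :=
  [set [set u.1; u.2] | u : G * G & adj u.1 u.2].

(* A graph on the vertex set of G is given by its set F of edges. *)
Definition deg (G : sgraph) (F : {set {set G}}) (v : G) : nat :=
  #|[set f in F | v \in f]|.

(* Degrees are smaller than #|G|, so the default value #|G| only matters when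
   there are no vertices. *)
Definition mindeg (G : sgraph) (F : {set {set G}}) : nat :=
  \big[minn/#|G|]_(v : G) deg F v.

Record position (G : sgraph) := Position {
  maker : {set {set G}};
  breaker : {set {set G}}
}.

Definition free (G : sgraph) (p : position G) : {set {set G}} :=
  edges G :\: (maker p :|: breaker p).

(* The edge Maker claims, as a function of all positions so far, the current
   one coming first. *)
Definition strategy (G : sgraph) := seq (position G) -> {set G}.

Variant player := Maker | Breaker.

(* [play b sigma t h]: the sequence of positions h, latest first, can arise in
   the (1:b) game when Maker follows sigma, and it is t's turn.  Breaker claims
   all the remaining edges if there are fewer than b of them; the game ends
   when no edge is free. *)
Inductive play (G : sgraph) (b : nat) (sigma : strategy G) :
    player -> seq (position G) -> Prop :=
| play_start : play b sigma Breaker [:: Position set0 set0]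
| play_breaker p h (A : {set {set G}}) :
    play b sigma Breaker (p :: h) -> free p != set0 ->
    A \subset free p -> #|A| = minn b #|free p| ->
    play b sigma Maker [:: Position (maker p) (breaker p :|: A), p & h]
| play_maker p h :
    play b sigma Maker (p :: h) -> free p != set0 ->
    play b sigma Breaker
      [:: Position (sigma (p :: h) |: maker p) (breaker p), p & h].

Definition legal (G : sgraph) (b : nat) (sigma : strategy G) : Prop :=
  forall p h, play b sigma Maker (p :: h) -> free p != set0 ->
    sigma (p :: h) \in free p.

(* Every play reaches, at the latest when the game ends, a minimum degree of at
   least c in Maker's graph. *)
Definition builds_mindeg (G : sgraph) (b : nat) (sigma : strategy G) (c : int) :
    Prop :=
  forall t p h, play b sigma t (p :: h) -> free p = set0 ->
    (c <= (mindeg (maker p))%:Z)%R.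

(* After m moves of Maker (he has claimed #|maker p| edges, one per move)
   Maker's graph has minimum degree at least c; together with [builds_mindeg],
   which covers plays ending earlier, this is success within m moves. *)
Definition mindeg_after (G : sgraph) (b : nat) (sigma : strategy G)
    (c m : int) : Prop :=
  forall t p h, play b sigma t (p :: h) -> (m <= #|maker p|%:Z)%R ->
    (c <= (mindeg (maker p))%:Z)%R.

(* "As long as d_M(v) <= c", at the moment p preceded by the moments h: v has
   not reached degree c before, so the phase lasts up to and including the
   moment at which d_M(v) becomes c.  Without the condition on the past no
   strategy could also reach minimum degree c within c * n moves: in the
   complete bipartite graph with parts of sizes d ~ 4 ln n and n - d, with
   b = c = 1, each edge of Maker meets the large part once, so all but d
   vertices of that part keep degree 1 from their first Maker edge until Maker
   is done, and Breaker has time to claim most of the edges at one of them. *)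
Definition as_long_as_le (G : sgraph) (c : int) (v : G)
    (p : position G) (h : seq (position G)) : bool :=
  ((deg (maker p) v)%:Z <= c)%R && all (fun q => (deg (maker q) v)%:Z < c)%R h.

(* Main.v *)
Require Import Defs.
From mathcomp Require Import all_boot all_order all_algebra.
From mathcomp Require Import reals exp.
From mathcomp Require Import lra zify.

Set Implicit Arguments.
Unset Strict Implicit.
Unset Printing Implicit Defensive.

Import Order.TTheory GRing.Theory Num.Theory.

Local Open Scope ring_scope.

(** Call a vertex active while its degree in Maker's graph is below [c], and
    let its danger be [d_B - 2 b d_M].  Maker always claims a free edge at an
    active vertex of maximal danger.  Writing [H_k] for the harmonic numbers,
    the following is preserved: before each move of Breaker, every set of [r]
    active vertices has average danger at most [2 b (H_n - H_r)].  Breaker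
    raises the total danger of a set by at most [2 b], and the danger of one
    vertex by at most [b].  Maker's move lowers the danger of the chosen
    vertex [v] by [2 b]; for a set [I] avoiding [v], maximality of [v] bounds
    the average over [I] by the average over [v |: I], and the passage from
    [r] to [r + 1] absorbs Breaker's contribution.  Singletons then give the
    bound [2 b (H_n - 1) + b], which is small enough for a free edge to remain
    at every active vertex. *)

(** * Degrees in sets of edges *)

Lemma deg_sum (G : sgraph) (F : {set {set G}}) v :
  deg F v = (\sum_(f in F) (v \in f))%N.
Proof.
rewrite /deg -sum1_card -big_mkcondr; apply: eq_bigl => f.
by rewrite inE.
Qed.

Lemma deg_leq_card (G : sgraph) (F : {set {set G}}) v : (deg F v <= #|F|)%N.
Proof. by rewrite subset_leq_card //; apply/subsetP => f; rewrite inE => /andP[]. Qed.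

Lemma deg0 (G : sgraph) (v : G) : deg set0 v = 0%N.
Proof. by rewrite deg_sum big_set0. Qed.

Lemma degS (G : sgraph) (E F : {set {set G}}) v :
  E \subset F -> (deg E v <= deg F v)%N.
Proof.
move=> /subsetP EF; apply: subset_leq_card; apply/subsetP => f.
by rewrite !inE => /andP[/EF -> ->].
Qed.

Lemma degU (G : sgraph) (E F : {set {set G}}) v :
  (deg (E :|: F) v <= deg E v + deg F v)%N.
Proof.
apply: leq_trans (leq_card_setU _ _); apply: subset_leq_card.
by apply/subsetP => f; rewrite !inE andb_orl.
Qed.

Lemma degU1 (G : sgraph) (e : {set G}) (F : {set {set G}}) v :
  e \notin F -> deg (e |: F) v = ((v \in e) + deg F v)%N.
Proof. by move=> eF; rewrite !deg_sum big_setU1. Qed.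

Lemma mindeg_leq (G : sgraph) (F : {set {set G}}) v : (mindeg F <= deg F v)%N.
Proof.
rewrite /mindeg; have := mem_index_enum v; elim: (index_enum G) => // w s IHs.
by rewrite inE big_cons geq_min => /predU1P[<-|/IHs ->]; rewrite ?leqnn ?orbT.
Qed.

Lemma mindeg_leq_card (G : sgraph) (F : {set {set G}}) : (mindeg F <= #|G|)%N.
Proof.
by rewrite /mindeg; elim/big_rec: _ => // v m _ h; rewrite geq_min h orbT.
Qed.

Lemma leq_mindeg (G : sgraph) (F : {set {set G}}) c :
  (c <= #|G|)%N -> (forall v, c <= deg F v)%N -> (c <= mindeg F)%N.
Proof.
by move=> cG h; rewrite /mindeg; elim/big_rec: _ => // v m _ cm; rewrite leq_min h.
Qed.

(** Double counting: an edge has at most two endpoints. This caps what Breaker's move adds to the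
    total danger of a set. *)
Lemma handshake_leq (G : sgraph) (A : {set {set G}}) (I : {set G}) :
  A \subset edges G -> (\sum_(v in I) deg A v <= 2 * #|A|)%N.
Proof.
move=> /subsetP AE; under eq_bigr do rewrite deg_sum.
rewrite exchange_big /= mulnC -sum_nat_const; apply: leq_sum => f fA.
have /imsetP[u _ ->] := AE f fA.
apply: (@leq_trans #|[set u.1; u.2]|); last by rewrite cards2; case: (_ == _).
rewrite -sum1_card big_mkcond [leqRHS]big_mkcond /=.
by apply: leq_sum => v _; do 2!case: (_ \in _).
Qed.

(** * Differences of harmonic numbers *)

Section Harmonic.
Context {R : realType}.

(** This is [H_n - H_r] for [r <= n]. *)
Definition harmonic_from (r n : nat) : R := \sum_(r <= i < n) i.+1%:R^-1.

Lemma harmonic_from_ge0 r n : 0 <= harmonic_from r n.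
Proof. by apply: sumr_ge0 => i _; rewrite invr_ge0. Qed.

Lemma harmonic_from_recl r n : (r < n)%N ->
  r.+1%:R * harmonic_from r n = 1 + r.+1%:R * harmonic_from r.+1 n.
Proof. by move=> rn; rewrite /harmonic_from big_ltn // mulrDr divff ?pnatr_eq0. Qed.

(** Telescope [ln n]; each difference is at least [1 / (i + 1)], by [ln (1 + x) <= x] at
    [x = - 1 / (i + 1)]. *)
Lemma harmonic_from1_le_ln n : (0 < n)%N -> harmonic_from 1 n <= ln n%:R.
Proof.
move=> n0; have <- : \sum_(1 <= i < n) (ln i.+1%:R - ln i%:R) = ln n%:R :> R.
  by rewrite (telescope_sumr (fun i => ln i%:R : R)) // ln1 subr0.
rewrite /harmonic_from !big_nat; apply: ler_sum => i /andP[i0 _].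
have iR : 0 < i%:R :> R by rewrite ltr0n.
have jR : 0 < i.+1%:R :> R by rewrite ltr0n.
rewrite -[leRHS]opprB -ln_div ?posrE // lerNr.
have -> : i%:R / i.+1%:R = 1 + - i.+1%:R^-1 :> R.
  apply: (mulIf (lt0r_neq0 jR)).
  by rewrite mulrDl mulNr divfK ?mulVf ?lt0r_neq0 // mul1r -natr1 addrK.
by apply: le_ln1Dx; rewrite ltrN2 invf_lt1 // ltr1n ltnS.
Qed.

End Harmonic.

(** * The greedy strategy and its invariant *)

Section Greedy.
Context {R : realType} {G : sgraph}.
Variables b c : nat.
Implicit Types (p : position G) (v : G) (e I : {set G}).

(* [all_algebra] exports another [free], on families of vectors. *)
Local Notation free := Defs.free.

Definition active p v : bool := (deg (maker p) v < c)%N.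

Definition danger p v : R :=
  (deg (breaker p) v)%:R - 2 * b%:R * (deg (maker p) v)%:R.

Definition most_dangerous p v : bool :=
  active p v && [forall w, active p w ==> (danger p w <= danger p v)].

(** The second [pick] keeps the strategy legal once no vertex is active; [set0] arises only on an
    empty history or when no edge is free. *)
Definition greedy : strategy G := fun h =>
  if h is p :: _ then
    if [pick u : G * {set G} |
          [&& most_dangerous p u.1, u.2 \in free p & u.1 \in u.2]] is Some u
    then u.2
    else odflt set0 [pick e in free p]
  else set0.

Definition claim_edge e p := Position (e |: maker p) (breaker p).
Definition claim_edges (A : {set {set G}}) p :=
  Position (maker p) (breaker p :|: A).

Lemma most_dangerous_exists p v : active p v -> exists w, most_dangerous p w.
Proof.
move=> av; case: (arg_maxP (danger p) av) => w aw max_w.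
by exists w; rewrite /most_dangerous aw; apply/forallP => u; apply/implyP/max_w.
Qed.

Definition open_at p v := exists2 e, e \in free p & v \in e.

Lemma greedyP p h :
  free p != set0 -> (forall v, active p v -> open_at p v) ->
  let e := greedy (p :: h) in
  e \in free p /\
  ((exists v, active p v) -> exists2 v, most_dangerous p v & v \in e).
Proof.
move=> /set0Pn[e0 fe0] open /=.
case: pickP => [[v e] /= /and3P[dv fe ve]|none]; first by split=> // _; exists v.
split=> [|[v /most_dangerous_exists[w dw]]].
  by case: pickP => [//|/(_ e0)]; rewrite fe0.
have [e fe we] := open w (proj1 (andP dw)).
by have := none (w, e); rewrite /= dw fe we.
Qed.

Local Notation slack I := (2 * b%:R * (#|I|%:R * harmonic_from #|I| #|G|)).

(** The first field bounds totals rather than averages. The second is separate because, on Maker's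
    turn, the first would allow a single vertex an excess of [2 * b] instead of [b]. The third
    counts moves: while some vertex is active, every edge of Maker has raised the sum of degrees
    capped at [c]. *)
Record controlled (t : player) p : Prop := Controlled {
  controlled_set : forall I, (forall v, v \in I -> active p v) ->
    \sum_(v in I) danger p v <= slack I + (if t is Maker then 2 * b%:R else 0);
  controlled_vertex : forall v, active p v ->
    danger p v <= b%:R * (2 * harmonic_from 1 #|G| + 1);
  controlled_size : forall v, active p v ->
    (#|maker p| <= \sum_v minn (deg (maker p) v) c)%N
}.

Lemma controlled_start : controlled Breaker (Position set0 set0).
Proof.
have d0 v : danger (Position set0 set0) v = 0.
  by rewrite /danger !deg0; lra.
split=> [I _|v _|v _]; last by rewrite cards0.
  under eq_bigr do rewrite d0.
  by rewrite big1 // addr0 !mulr_ge0 // harmonic_from_ge0.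
by rewrite d0 mulr_ge0 // addr_ge0 // mulr_ge0 // harmonic_from_ge0.
Qed.

Lemma controlled_claim_edges p (A : {set {set G}}) :
  A \subset edges G -> (#|A| <= b)%N ->
  controlled Breaker p -> controlled Maker (claim_edges A p).
Proof.
move=> AE Ab [setP vertexP sizeP].
have dangerU v : danger (claim_edges A p) v <= danger p v + (deg A v)%:R.
  by have := degU (breaker p) A v; rewrite /danger /= -(ler_nat R) natrD; lra.
split=> [I aI|v av|//].
  apply: le_trans (ler_sum _ (fun v _ => dangerU v)) _.
  rewrite big_split /= lerD //; first by have := setP I aI; rewrite addr0.
  by rewrite -natr_sum -natrM ler_nat (leq_trans (handshake_leq I AE)) ?leq_mul2l.
have av1 w : w \in [set v] -> active p w by rewrite inE => /eqP ->.
have := setP _ av1; rewrite big_set1 cards1 mul1r addr0.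
have : (deg A v)%:R <= b%:R :> R by rewrite ler_nat (leq_trans (deg_leq_card A v)).
by have := dangerU v; lra.
Qed.

Lemma danger_claim_edge e p v : e \in free p ->
  danger (claim_edge e p) v = danger p v - (if v \in e then 2 * b%:R else 0).
Proof.
rewrite !inE negb_or -andbA => /and3P[eM _ _].
by rewrite /danger /= degU1 // natrD; case: (v \in e); rewrite ?mulr1n ?mulr0n; lra.
Qed.

Lemma danger_claim_edge_le e p v : e \in free p ->
  danger (claim_edge e p) v <= danger p v.
Proof.
by move=> /danger_claim_edge ->; case: ifP => _; rewrite ?subr0 // gerBl mulr_ge0.
Qed.

Lemma active_claim_edge e p v : active (claim_edge e p) v -> active p v.
Proof. by apply: leq_trans; rewrite ltnS degS ?subsetUr. Qed.

Lemma controlled_claim_edge p e : e \in free p ->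
  ((exists v, active p v) -> exists2 v, most_dangerous p v & v \in e) ->
  controlled Maker p -> controlled Breaker (claim_edge e p).
Proof.
move=> fe dangerous [setP vertexP sizeP].
have eM : e \notin maker p by move: fe; rewrite !inE negb_or -andbA => /and3P[].
have le_danger v := @danger_claim_edge_le e p v fe.
split=> [I aI|v av|v /active_claim_edge av].
- have {}aI v : v \in I -> active p v by move=> /aI/active_claim_edge.
  rewrite addr0; have [->|[u uI]] := set_0Vmem I.
    by rewrite big_set0 cards0 mul0r mulr0.
  have [v /andP[av /forallP max_v] ve] := dangerous (ex_intro _ u (aI u uI)).
  have le_sum : \sum_(w in I) danger (claim_edge e p) w <= \sum_(w in I) danger p w.
    by apply: ler_sum => w _.
  (* If [v] lies in [I], the loss of [2 * b] at [v] cancels the excess left by Breaker. *)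
  have [vI|vI] := boolP (v \in I).
    have := setP I aI; rewrite (bigD1 v vI) /= => sumI; rewrite (bigD1 v vI) /=.
    rewrite danger_claim_edge // ve.
    have : \sum_(w in I | w != v) danger (claim_edge e p) w
        <= \sum_(w in I | w != v) danger p w by apply: ler_sum => w _.
    by move: sumI; lra.
  (* Otherwise the invariant is applied to [v |: I], of size [r + 1] where [r = #|I|]. *)
  have rG : (#|I| < #|G|)%N.
    by rewrite -[X in (X <= _)%N](_ : #|v |: I| = _) ?max_card // cardsU1 vI.
  have aJ w : w \in v |: I -> active p w by rewrite !inE => /orP[/eqP ->|/aI].
  have := setP (v |: I) aJ; rewrite big_setU1 //= cardsU1 vI add1n => sumJ.
  have sumI : \sum_(w in I) danger p w <= #|I|%:R * danger p v.
    rewrite mulr_natl -sumr_const; apply: ler_sum => w wI.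
    exact: (implyP (max_v w)) (aI w wI).
  apply: le_trans le_sum _.
  have r0 : 0 < #|I|.+1%:R :> R by rewrite ltr0n.
  rewrite -(ler_pM2l r0).
  have := harmonic_from_recl (R := R) rG; set h := harmonic_from _ _.
  set h' := harmonic_from _ _ => hh'.
  rewrite -/h' in sumJ.
  (* Both sides were scaled by [r + 1]; the sum over [I] is at most [r] times the danger of [v]. *)
  apply: (@le_trans _ _ (#|I|%:R * (danger p v + \sum_(w in I) danger p w))).
    by rewrite mulrDr -natr1 mulrDl mul1r; lra.
  apply: le_trans (ler_wpM2l (ler0n _ _) sumJ) _.
  rewrite le_eqVlt; apply/orP; left; apply/eqP.
  transitivity (2 * b%:R * #|I|%:R * (1 + #|I|.+1%:R * h')); first by lra.
  by rewrite -hh'; lra.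
- by apply: le_trans (le_danger v) _; apply: vertexP; apply: active_claim_edge av.
have [w /andP[aw _] we] := dangerous (ex_intro _ v av).
rewrite /= cardsU1 eM add1n.
apply: leq_ltn_trans (sizeP _ av) _.
(* The endpoint [w] was below the cap, so its term grows by one and pays for the new edge. *)
rewrite (bigD1 w) //= [ltnRHS](bigD1 w) //= degU1 // we.
rewrite -addSn leq_add //.
  by move: aw; rewrite /active; lia.
apply: leq_sum => u _; rewrite degU1 //; lia.
Qed.

(** * Free edges at active vertices, and what the strategy achieves *)

Hypothesis room :
  (c * (2 * b + 1))%:R + 2 * b%:R * harmonic_from 1 #|G|
    <= (mindeg (edges G))%:R :> R.

(** With [H = H_n - 1], the danger bound gives [d_M + d_B <= (2b + 1) d_M + 2bH + b < (2b + 1)(d_M +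
    1) + 2bH]. Since [d_M + 1 <= c], this is at most the minimum degree, so some edge at [v] is
    unclaimed. *)
Lemma controlled_open t p v : controlled t p -> active p v -> open_at p v.
Proof.
move=> ctl av; have := controlled_vertex ctl av; rewrite /danger => dv.
suff : (0 < deg (free p) v)%N.
  by move=> /card_gt0P[e]; rewrite inE => /andP[]; exists e.
have cover : (deg (edges G) v
    <= deg (free p) v + (deg (maker p) v + deg (breaker p) v))%N.
  apply: leq_trans (leq_add (leqnn _) (degU _ _ _)).
  apply: leq_trans (degU _ _ _); apply: degS; apply/subsetP => e eE.
  by rewrite !inE eE andbT; case: (e \in maker p); case: (e \in breaker p).
have := leq_trans (mindeg_leq _ v) cover; rewrite -(ler_nat R) !natrD => le_deg.
have lt_c : ((deg (maker p) v).+1 * (2 * b + 1))%:R <= (c * (2 * b + 1))%:R :> R.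
  by rewrite ler_nat leq_mul2r [(_ < c)%N]av orbT.
rewrite -(ltr_nat R); move: lt_c room dv le_deg.
rewrite !(natrM, natrD) -natr1.
have : 0 <= b%:R :> R by [].
by lra.
Qed.

Lemma play_controlled t H : play b greedy t H ->
  if H is p :: _ then controlled t p else True.
Proof.
elim=> {t H} [|p h A _ ctl _ Af Ab|p h _ ctl fr].
- exact: controlled_start.
- apply: controlled_claim_edges ctl; last by rewrite Ab geq_minl.
  by apply: subset_trans Af _; apply: subsetDl.
have [fe dangerous] := greedyP h fr (fun v => @controlled_open _ _ v ctl).
exact: controlled_claim_edge.
Qed.

Lemma greedy_legal : legal b greedy.
Proof.
move=> p h /play_controlled ctl fr.
exact: (greedyP h fr (fun v => @controlled_open _ _ v ctl)).1.
Qed.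

(** Needed because the default value in [mindeg] caps it at [#|G|]. *)
Lemma c_leq_card : (c <= #|G|)%N.
Proof.
rewrite (leq_trans _ (mindeg_leq_card (edges G))) //.
rewrite -(ler_nat R); apply: le_trans room.
apply: (@le_trans _ _ (c * (2 * b + 1))%:R).
  by rewrite ler_nat leq_pmulr // addn1.
by rewrite lerDl !mulr_ge0 // harmonic_from_ge0.
Qed.

Lemma inactive_mindeg p : (forall v, ~~ active p v) -> (c <= mindeg (maker p))%N.
Proof.
move=> inact; apply: leq_mindeg c_leq_card _ => v.
by have := inact v; rewrite /active -leqNgt.
Qed.

Lemma greedy_builds_mindeg : builds_mindeg b greedy c.
Proof.
move=> t p h /play_controlled ctl fr; rewrite lez_nat; apply: inactive_mindeg => v.
by apply/negP => /(controlled_open ctl)[e]; rewrite fr inE.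
Qed.

(** An active vertex would make the capped degree sum strictly less than [c * #|G|], yet that sum
    bounds Maker's number of edges. *)
Lemma greedy_mindeg_after : mindeg_after b greedy c (c%:Z * #|G|%:Z).
Proof.
move=> t p h /play_controlled ctl; rewrite -PoszM !lez_nat => cM.
apply: inactive_mindeg => v; apply/negP => av.
have := leq_trans cM (controlled_size ctl av); apply/negP; rewrite -ltnNge.
have -> : (c * #|G| = \sum_(w : G) c)%N by rewrite big_const iter_addn_0.
rewrite (bigD1 v) //= [ltnRHS](bigD1 v) //= -addSn.
rewrite leq_add //; first by rewrite gtn_min [(_ < c)%N]av.
by apply: leq_sum => w _; apply: geq_minr.
Qed.

(** The phase includes the moment when [v] reaches degree [c] and is no longer active. One position
    earlier [v] was active; Breaker's move keeps it so, and Maker's move cannot raise its danger. *)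
Lemma greedy_danger t p h v :
  play b greedy t (p :: h) -> as_long_as_le c v p h ->
  danger p v <= b%:R * (2 * harmonic_from 1 #|G| + 1).
Proof.
move=> pl; case: _ {-1}_ / pl (erefl (p :: h)) (play_controlled pl)
  => [|q h' A _ _ _ _|q h' pl fr] [-> ->] ctl.
- move=> _; rewrite /danger !deg0 mulr0 subr0.
  by rewrite mulr_ge0 // addr_ge0 // mulr_ge0 // harmonic_from_ge0.
- by case/and3P=> _ av _; apply: (controlled_vertex ctl); rewrite /active -ltz_nat.
case/and3P=> _ aq _; apply: le_trans (danger_claim_edge_le _ (greedy_legal pl fr)) _.
by apply: (controlled_vertex (play_controlled pl)); rewrite /active -ltz_nat.
Qed.

End Greedy.

Theorem theorem2p2 (R : realType) :
  exists n0 : nat, forall n : nat, (n0 <= n)%N ->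
  forall (G : sgraph) (b : nat) (c : int),
    #|G| = n ->
    (0 < b)%N ->
    b%:R <= (mindeg (edges G))%:R / (4 * ln (n%:R : R)) ->
    c%:~R * (2 * b%:R + 1) <= (mindeg (edges G))%:R / 3 :> R ->
  exists sigma : strategy G,
    [/\ legal b sigma,
        builds_mindeg b sigma c,
        mindeg_after b sigma c (c * n%:Z)
      & forall (t : player) (p : position G) (h : seq (position G)),
          play b sigma t (p :: h) ->
          forall v : G, as_long_as_le c v p h ->
            (deg (breaker p) v)%:R - 2 * b%:R * (deg (maker p) v)%:R
              <= b%:R * (2 * ln (n%:R : R) + 1)].
Proof.
(* From 2 on, [ln n] is positive, so the denominator in the bound on [b] can be cleared. *)
exists 2%N => n n2 G b c Gn b0 le_b le_c.
have harm_ln : harmonic_from 1 #|G| <= ln n%:R :> R.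
  by rewrite Gn harmonic_from1_le_ln // ltnW.
have ln0 : 0 < ln n%:R :> R by rewrite ln_gt0 // ltr1n.
have b_ln : b%:R * (4 * ln n%:R) <= (mindeg (edges G))%:R :> R.
  by rewrite -ler_pdivlMr // mulr_gt0.
have b_harm : b%:R * harmonic_from 1 #|G| <= b%:R * ln n%:R :> R.
  by rewrite ler_wpM2l.
have d0 : 0 <= (mindeg (edges G))%:R :> R by [].
(* A negative [c] is replaced by 0. The room suffices since the two terms take at most [1/3] and
   [1/2] of the minimum degree. *)
have [k [c_k room]] : exists k : nat, (c = k%:Z \/ c < 0) /\
    (k * (2 * b + 1))%:R + 2 * b%:R * harmonic_from 1 #|G|
      <= (mindeg (edges G))%:R :> R.
  case: c le_c => [m|m] le_c; last first.
    by exists 0%N; split; [right|rewrite mul0n; lra].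
  exists m; split; first by left.
  by move: le_c; rewrite !(natrM, natrD) -[m%:~R]/m%:R; lra.
exists (greedy (R := R) b k); split.
- exact: greedy_legal room.
- move=> t p h pl fr; case: c_k => [->|c0]; first exact: greedy_builds_mindeg pl fr.
  by apply: le_trans (ltW c0) _.
- move=> t p h pl; case: c_k => [->|c0 _]; last by apply: le_trans (ltW c0) _.
  by rewrite -Gn; apply: greedy_mindeg_after pl.
move=> t p h pl v; case: c_k => [->|c0].
  by move=> /(greedy_danger room pl); rewrite /danger; lra.
(* For negative [c] no degree is at most [c], so the phase is empty. *)
by case/andP=> /le_lt_trans/(_ c0).
Qed.
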